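(* Let $X$ be a nonzero real Banach space. An operator $S:\mathscr{C}(X)\to\mathscr{C}_{w^*}(X^* )$ is fully order reversing if and only if there exist $v\in X^*$, $y\in X$, $\rho\in\mathbb{R}$, $\tau\in\mathbb{R}$ with $\tau>0$, and a continuous automorphism $H$ of $X$ such that $$S(f)(u)=\tau f^*(H^*u+v)+\langle u,y\rangle+\rho$$ for all $f\in\mathscr{C}(X)$ and all $u\in X^*$.
   Context: $X^*$ is the topological dual of $X$ and $\langle u,x\rangle=u(x)$ for $u\in X^*$, $x\in X$. $\mathscr{C}(X)$ is the set of proper (not identically $+\infty$), convex, (norm) lower semicontinuous functions $f:X\to\mathbb{R}\cup\{+\infty\}$. $\mathscr{C}_{w^*}(X^* )$ is the set of proper, convex, weak$^*$ lower semicontinuous functions $g:X^*\to\mathbb{R}\cup\{+\infty\}$. Both sets are ordered pointwise. For $f\in\mathscr{C}(X)$, the Fenchel conjugate is $f^*(u)=\sup_{x\in X}\{\langle u,x\rangle-f(x)\}$, $u\in X^*$. An operator $S:\mathscr{C}(X)\to\mathscr{C}_{w^*}(X^* )$ (an arbitrary map) is fully order reversing if it is onto and, for all $f,g\in\mathscr{C}(X)$, $f\le g$ if and only if $S(f)\ge S(g)$. A continuous automorphism of $X$ is a continuous linear bijection $X\to X$; $H^*:X^*\to X^*$ is the adjoint of $H$, $\langle H^*u,x\rangle=\langle u,Hx\rangle$. *)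

(* Defs.v *)
From HB Require Import structures.
From mathcomp Require Import all_boot all_order all_algebra.
From mathcomp Require Import all_classical all_reals all_analysis.

Set Implicit Arguments.
Unset Strict Implicit.
Unset Printing Implicit Defensive.

Import Order.TTheory GRing.Theory Num.Theory.
Import numFieldNormedType.Exports.

Local Open Scope classical_set_scope.
Local Open Scope ring_scope.

Section continuous_dual.
Context {R : realType} (X : normedModType R).

Definition continuous_linear_form : {pred X -> R^o} :=
  [pred u : X -> R^o | `[< linear u /\ continuous u >]].

Lemma continuous_linear_form_submod_closed :
  submod_closed continuous_linear_form.
Proof.
split=> [|a u v /asboolP[lu cu] /asboolP[lv cv]]; apply/asboolP; split.
- by move=> a x y /=; rewrite scaler0 addr0.
- by move=> x; exact: cvg_cst.
- move=> b x y; rewrite !fctE lu lv !scalerDr !scalerA [a * b]mulrC.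
  by rewrite -!addrA; congr (_ + _); rewrite addrCA.
- by move=> x; apply: cvgD; [apply: cvgZl_tmp; exact: cu|exact: cv].
Qed.

HB.instance Definition _ := GRing.isSubmodClosed.Build R (X -> R^o)
  continuous_linear_form continuous_linear_form_submod_closed.

Record continuous_dual := ContinuousDual {
  dual_fun :> X -> R^o ;
  _ : dual_fun \in continuous_linear_form }.

HB.instance Definition _ := [isSub for dual_fun].
HB.instance Definition _ := [Choice of continuous_dual by <:].
HB.instance Definition _ :=
  [SubChoice_isSubLmodule of continuous_dual by <:].

(* The weak-* topology: the coarsest one making every evaluation
   u |-> u x continuous, i.e., the topology induced by pointwise convergence *)
Definition weak_star : Type :=
  initial_topology (dual_fun : continuous_dual -> {ptws X -> R^o}).

HB.instance Definition _ := Topological.on weak_star.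

End continuous_dual.

Lemma adjoint_subproof (R : realType) (X : normedModType R)
    (H : {linear X -> X}) (cH : continuous H) (u : continuous_dual X) :
  (u : X -> R^o) \o H \in @continuous_linear_form R X.
Proof.
case: u => u /asboolP[lu cu] /=; apply/asboolP; split.
  by move=> a x y /=; rewrite linearP lu.
by move=> x; apply: continuous_comp; [exact: cH|exact: cu].
Qed.

Definition adjoint (R : realType) (X : normedModType R)
    (H : {linear X -> X}) (cH : continuous H) (u : continuous_dual X) :
    continuous_dual X :=
  ContinuousDual (adjoint_subproof cH u).

Local Open Scope ereal_scope.

Definition proper_fun (R : realType) (T : Type) (f : T -> \bar R) :=
  (forall x, f x != -oo) /\ exists x, f x != +oo.

(* Meant for proper f, so that the right-hand side never is +oo - oo; the
   endpoints t = 0 and t = 1 impose nothing. *)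
Definition econvex_fun (R : realType) (E : lmodType R) (f : E -> \bar R) :=
  forall (x y : E) (t : R), (0 < t < 1)%R ->
    f (t *: x + (1 - t) *: y)%R <= t%:E * f x + (1 - t)%:E * f y.

Definition convex_lsc (R : realType) (X : normedModType R) :
    set (X -> \bar R) :=
  [set f | [/\ proper_fun f, econvex_fun f & lower_semicontinuous f]].
Arguments convex_lsc {R} X.

Definition convex_wstar_lsc (R : realType) (X : normedModType R) :
    set (continuous_dual X -> \bar R) :=
  [set g | [/\ proper_fun g, econvex_fun g &
    lower_semicontinuous (g : weak_star X -> \bar R)]].
Arguments convex_wstar_lsc {R} X.

Definition fenchel_conjugate (R : realType) (X : normedModType R)
    (f : X -> \bar R) (u : continuous_dual X) : \bar R :=
  ereal_sup [set (u x)%:E - f x | x in [set: X]].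

Definition fully_order_reversing (R : realType) (X : normedModType R)
    (S : convex_lsc X -> convex_wstar_lsc X) :=
  (forall g : convex_wstar_lsc X, exists f : convex_lsc X, S f = g) /\
  (forall f g : convex_lsc X,
    (forall x, val f x <= val g x) <->
    (forall u, val (S f) u >= val (S g) u)).

(* Main.v *)
(* The functions x |-> u x + a are the elements of C(X) below which the order is
   total, and the functions equal to r at one point x and to +oo elsewhere are
   those above which it is total; the same holds in C_w*(X'). The first
   statement is Fenchel-Moreau duality, proved by Hahn-Banach for a sublinear
   functional built from the convex function and a seminorm. So S maps affine
   functions (u, a) to point functions (phi u, sigma u a), and point functions
   (x, r) to evaluations u |-> u (theta x) + beta x r. As (u, a) <= (x, r) means
   u x + a <= r, S being order reversing gives
     phi u (theta x) + beta x (u x + a) = sigma u a   for all u, x, a.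
   This functional equation alone forces, up to translations,
   phi u (theta z) = tau * u z with tau > 0. Hence theta is affine, and its linear
   part is continuous by Banach-Steinhaus. Finally S f w <= s holds iff the affine
   function that S maps to the point function (w, s) lies below f, which is a
   condition on the conjugate of f. In the converse direction, the order is
   reflected because H^-1 is continuous (open mapping theorem). *)

Require Import Defs.
From HB Require Import structures.
From mathcomp Require Import all_boot all_order all_algebra.
From mathcomp Require Import all_classical all_reals all_analysis.
From mathcomp Require Import ring lra.

Set Implicit Arguments.
Unset Strict Implicit.
Unset Printing Implicit Defensive.

Import Order.TTheory GRing.Theory Num.Theory.
Import numFieldNormedType.Exports.

Local Open Scope classical_set_scope.
Local Open Scope ring_scope.

(** * The Hahn-Banach theorem *)

Definition pack_linear (R : pzRingType) (E F : lmodType R) (f : E -> F)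
    (lf : linear f) : {linear E -> F} :=
  HB.pack f (GRing.isLinear.Build _ _ _ _ _ lf).

Section hahn_banach.
Context {R : realType} {E : lmodType R}.
Implicit Types (q p : E -> R) (x y d : E).

Definition sublinear q := [/\ q 0 = 0,
  forall x y, q (x + y) <= q x + q y &
  forall t x, 0 < t -> q (t *: x) <= t * q x].

Lemma inf_leD (A B C : set R) : A !=set0 -> B !=set0 -> has_lbound C ->
  (forall a b, A a -> B b -> exists2 c, C c & c <= a + b) ->
  inf C <= inf A + inf B.
Proof.
move=> A0 B0 lC ABC; rewrite addrC -lerBlDr; apply: lb_le_inf => // b Bb.
rewrite lerBlDr addrC -lerBlDr; apply: lb_le_inf => // a Aa.
rewrite lerBlDr; have [c Cc cab] := ABC _ _ Aa Bb.
exact: le_trans (ge_inf lC Cc) cab.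
Qed.

Lemma inf_leM (A B : set R) t : 0 < t -> A !=set0 -> has_lbound B ->
  (forall a, A a -> exists2 b, B b & b <= t * a) -> inf B <= t * inf A.
Proof.
move=> t0 A0 lB AB; rewrite -ler_pdivrMl//; apply: lb_le_inf => // a Aa.
rewrite ler_pdivrMl//; have [b Bb bta] := AB _ Aa.
exact: le_trans (ge_inf lB Bb) bta.
Qed.

Lemma sublinearZ q t x : sublinear q -> 0 <= t -> q (t *: x) = t * q x.
Proof.
move=> [q0 _ qZ]; rewrite le_eqVlt => /predU1P[<-|t0].
  by rewrite scale0r mul0r.
apply/eqP; rewrite eq_le qZ//= mulrC -ler_pdivlMr// mulrC.
have := qZ t^-1 (t *: x).
by rewrite invr_gt0 scalerA mulVf ?gt_eqF// scale1r; apply.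
Qed.

Lemma sublinear_ge q x : sublinear q -> - q (- x) <= q x.
Proof. by case=> q0 qD _; rewrite -subr_ge0 opprK -q0 -(subrr x) qD. Qed.

(** The pointwise infimum of the chain works. It is finite because [u x >= - u (- x) >= - q (- x)]
    for each member [u]; comparability of two members is what makes it subadditive. *)
Lemma sublinear_chain_inf q (A : set (E -> R)) :
  (forall u, A u -> sublinear u /\ forall x, u x <= q x) -> A !=set0 ->
  (forall u v, A u -> A v -> (forall x, u x <= v x) \/ (forall x, v x <= u x)) ->
  exists m, [/\ sublinear m, forall x, m x <= q x &
    forall u, A u -> forall x, m x <= u x].
Proof.
move=> Asub [u0 Au0] Atot; pose V x := [set u x | u in A].
have V0 x : V x !=set0 by exists (u0 x), u0.
have lV x : has_lbound (V x).
  exists (- q (- x)) => _ [u /Asub[su uq] <-].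
  by apply: le_trans (sublinear_ge _ su); rewrite lerN2.
have mA u : A u -> forall x, inf (V x) <= u x.
  by move=> Au x; apply: ge_inf (lV x) _ _; exists u.
exists (fun x => inf (V x)); split=> //; last first.
  by move=> x; apply: le_trans (mA _ Au0 x) _; have [] := Asub _ Au0.
split=> [|x y|t x t0].
- rewrite /V (_ : [set _ | _ in _] = [set 0]) ?inf1// eqEsubset; split=> r /=.
    by move=> [u /Asub[[u00 _ _] _] <-].
  by move=> ->; exists u0 => //; have [[]] := Asub _ Au0.
- apply: inf_leD => // _ _ [u Au <-] [v Av <-].
  have [[_ uD _] _] := Asub _ Au; have [[_ vD _] _] := Asub _ Av.
  have [uv|vu] := Atot _ _ Au Av.
    by exists (u (x + y)); [exists u|rewrite (le_trans (uD _ _))// lerD2l].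
  by exists (v (x + y)); [exists v|rewrite (le_trans (vD _ _))// lerD2r].
- apply: inf_leM => // _ [u Au <-]; have [[_ _ uZ] _] := Asub _ Au.
  by exists (u (t *: x)); [exists u|exact: uZ].
Qed.

(** Zorn's lemma for the reversed pointwise order; the empty chain is bounded by [q] itself. *)
Lemma minimal_sublinear q : sublinear q ->
  exists m, [/\ sublinear m, forall x, m x <= q x &
    forall u, sublinear u -> (forall x, u x <= m x) -> u = m].
Proof.
move=> sq; pose T := {u : E -> R | sublinear u /\ forall x, u x <= q x}.
pose le (s t : T) := `[< forall x, projT1 t x <= projT1 s x >].
have [|r s t /asboolP rs /asboolP st|[s ps] [t pt] /asboolP/= st /asboolP/= ts|
  A Atot|[m [sm mq]] mmax] := @Zorn T le.
- by move=> t; apply/asboolP.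
- by apply/asboolP => x; exact: le_trans (st x) (rs x).
- apply: eq_exist => /=.
  by apply/funext => x; apply/eqP; rewrite eq_le st ts.
- have [A0|/set0P A0] := eqVneq A set0.
    by exists (exist _ q (conj sq (fun=> lexx _))) => s; rewrite A0.
  have [_ [t _ <-]|||m [sm mq mA]] :=
      @sublinear_chain_inf q [set projT1 u | u in A].
  + exact: (projT2 t).
  + by have [t At] := A0; exists (projT1 t), t.
  + move=> _ _ [s As <-] [t At <-].
    by have [/asboolP|/asboolP] := Atot _ _ As At; [right|left].
  + exists (exist _ m (conj sm mq)) => s As; apply/asboolP => x /=.
    by apply: mA; exists s.
exists m; split=> // u su um.
have uq x : u x <= q x by exact: le_trans (um x) (mq x).
by have [] :
  exist _ u (conj su uq) = exist _ m (conj sm mq) :> T by apply/mmax/asboolP.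
Qed.

(* Minimality below the functional d |-> inf_(t >= 0) m (d + t x) - t m x,
   which takes a value at most - m x at - x, forces m to be odd. *)
Lemma minimal_sublinear_odd m : sublinear m ->
  (forall u, sublinear u -> (forall x, u x <= m x) -> u = m) ->
  forall x, m (- x) = - m x.
Proof.
move=> sm mmin x; have [m0 mD mZ] := sm.
pose V d := [set m (d + t *: x) - t * m x | t in [set t | 0 <= t]].
have V0 d : V d !=set0 by exists (m (d + 0 *: x) - 0 * m x), 0 => /=.
have Vge d r : V d r -> - m (- d) <= r.
  move=> [t t0 <-].
  have := mD (- d) (d + t *: x); rewrite addKr (sublinearZ _ sm)//; lra.
have lV d : has_lbound (V d) by exists (- m (- d)) => r /Vge.
have um d : inf (V d) <= m d.
  apply: ge_inf (lV d) _ _; exists 0 => //=.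
  by rewrite scale0r addr0 mul0r subr0.
have su : sublinear (fun d => inf (V d)).
  split=> [|d e|t d t0].
  - apply/eqP; rewrite eq_le -{1}m0 um /=.
    by apply: lb_le_inf => // r /Vge; rewrite oppr0 m0 oppr0.
  - apply: inf_leD => // _ _ [s s0 <-] [t t0 <-].
    exists (m (d + e + (s + t) *: x) - (s + t) * m x).
      by exists (s + t) => //=; exact: addr_ge0.
    have := mD (d + s *: x) (e + t *: x).
    by rewrite addrACA -scalerDl; lra.
  - apply: inf_leM => // _ [s s0 <-].
    exists (m (t *: d + (t * s) *: x) - (t * s) * m x).
      by exists (t * s) => //=; rewrite mulr_ge0// ltW.
    by rewrite mulrBr mulrA lerD2r -scalerA -scalerDr mZ.
have /(congr1 (@^~ (- x)))/= ux := mmin _ su um.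
apply/eqP; rewrite eq_le; apply/andP; split.
  rewrite -ux; apply: ge_inf (lV _) _ _; exists 1 => /=; first exact: ler01.
  by rewrite scale1r addNr m0 mul1r sub0r.
by have := sublinear_ge (- x) sm; rewrite opprK.
Qed.

(** A minimal sublinear functional is odd, and oddness turns subadditivity into additivity and
    extends positive homogeneity to all scalars. *)
Theorem hahn_banach q : sublinear q ->
  exists u : {linear E -> R^o}, forall x, u x <= q x.
Proof.
move=> /minimal_sublinear[m [sm mq mmin]].
have mN := minimal_sublinear_odd sm mmin; have [m0 mD mZ] := sm.
have mDE x y : m (x + y) = m x + m y.
  apply/eqP; rewrite eq_le mD/=.
  by have := mD (- x) (- y); rewrite -opprD !mN; lra.
have mZE a x : m (a *: x) = a * m x.
  have [a0|a0] := leP 0 a; first exact: sublinearZ.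
  rewrite -[a *: x]opprK mN -scaleNr (sublinearZ _ sm) ?oppr_ge0 ?ltW//.
  by rewrite mulNr opprK.
have lm : linear (m : E -> R^o) by move=> a x y; rewrite mDE mZE.
by exists (pack_linear lm).
Qed.

End hahn_banach.

(** * Affine minorants of convex functions *)

Section affine_minorant.
Context {R : realType} {E : lmodType R}.
Implicit Types (f : E -> \bar R) (p : E -> R) (x y d : E).

(** An abstract seminorm lets one argument cover both the norm of [X] and the finite sums of [|v x|]
    that describe weak-* neighbourhoods. *)
Definition is_seminorm p :=
  (forall x y, p (x + y) <= p x + p y) /\ (forall a x, p (a *: x) = `|a| * p x).

Lemma is_seminorm0 p : is_seminorm p -> p 0 = 0.
Proof. by case=> _ pZ; rewrite -(scale0r 0) pZ normr0 mul0r. Qed.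

Lemma is_seminormN p x : is_seminorm p -> p (- x) = p x.
Proof. by case=> _ pZ; rewrite -scaleN1r pZ normrN1 mul1r. Qed.

Lemma is_seminorm_ge0 p x : is_seminorm p -> 0 <= p x.
Proof.
move=> sp; have [pD _] := sp; have := pD x (- x).
by rewrite subrr is_seminorm0// is_seminormN//; lra.
Qed.

Lemma econvex_fun_fin f x y a b t : econvex_fun f -> (forall z, f z != -oo%E) ->
  f x = a%:E -> f y = b%:E -> 0 < t < 1 ->
  exists2 c, f (t *: x + (1 - t) *: y) = c%:E & c <= t * a + (1 - t) * b.
Proof.
move=> cf fNy fx fy t01; have := cf x y t t01; rewrite fx fy -!EFinM -EFinD.
have := fNy (t *: x + (1 - t) *: y); case: (f _) => [c|//|//] _.
by rewrite lee_fin; exists c.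
Qed.

(** A lower bound on a ball around [x] spreads to linear decay everywhere. For [y] outside the ball,
    [t = 1 / (2 p (y - x))] puts [t y + (1 - t) x] at distance 1/2 from [x], and convexity carries
    the bound there to [y]. *)
Lemma econvex_fun_ge_seminorm f p x y r : econvex_fun f ->
  (forall z, f z != -oo%E) -> is_seminorm p -> f x = r%:E ->
  (forall z, p (z - x) < 1 -> ((r - 1)%:E < f z)%E) ->
  ((r - 1 - 2 * p (y - x))%:E <= f y)%E.
Proof.
move=> cf fNy sp fx f1; case fy: (f y) => [b| |]; last 2 first.
- by rewrite leey.
- by have := fNy y; rewrite fy.
rewrite lee_fin; have p0 := is_seminorm_ge0 (y - x) sp.
have [p1|p1] := ltP (p (y - x)) 1.
  by have := f1 _ p1; rewrite fy lte_fin; lra.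
pose P := p (y - x); pose t := (2 * P)^-1.
have P0 : 0 < P by rewrite /P; lra.
have tP : t * P = 2^-1 by rewrite /t invfM -mulrA mulVf ?mulr1// gt_eqF.
have t0 : 0 < t by rewrite invr_gt0 mulr_gt0.
have t1 : t < 1 by rewrite /t invf_lt1 ?mulr_gt0//; rewrite /P; lra.
have [|c fc cle] := econvex_fun_fin cf fNy fy fx (t := t); first by rewrite t0.
have := f1 (t *: y + (1 - t) *: x).
have -> : t *: y + (1 - t) *: x - x = t *: (y - x).
  by rewrite scalerBl scale1r scalerBr addrCA addrC addrK.
rewrite sp.2 gtr0_norm// tP fc lte_fin => /(_ _)/lt_le_trans/(_ cle) => rt.
have h : 0 <= t * b + (1 - t) * r - (r - 1).
  by rewrite subr_ge0 ltW// rt//; lra.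
have : 0 <= (2 * P) * (t * b + (1 - t) * r - (r - 1)) by apply: mulr_ge0 h; lra.
have -> : 2 * P * (t * b + (1 - t) * r - (r - 1)) = 2 * (t * P) * (b - r) + 2 * P by ring.
by rewrite tP -/P; lra.
Qed.

(** The bound around [x] limits the decay of [f] far away, and the bound around [x0] leaves room for
    the value [s] at [x0]. Together they give [s <= f y + K * p (y - x0)], from which Hahn-Banach
    produces the slope. *)
Lemma seminorm_affine_minorant f p x0 x r s : econvex_fun f ->
  (forall z, f z != -oo%E) -> is_seminorm p -> f x = r%:E ->
  (forall z, p (z - x) < 1 -> ((r - 1)%:E < f z)%E) ->
  (forall z, p (z - x0) < 1 -> (s%:E < f z)%E) ->
  exists (u : {linear E -> R^o}) (K : R),
    (forall d, `|u d| <= K * p d) /\ (forall y, ((u (y - x0) + s)%:E <= f y)%E).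
Proof.
move=> cf fNy sp fx f1 fs; have [pD pZ] := sp.
have p0 d : 0 <= p d by exact: is_seminorm_ge0.
have pN d : p (- d) = p d by exact: is_seminormN.
(* The decay of [f] costs a slope 2; where [p (y - x0) >= 1], the remaining [K - 2] absorbs all the
   constants. *)
pose K := 3 + `|s| + `|r| + 2 * p (x0 - x).
have K0 : 0 <= K by 
  rewrite /K; have := p0 (x0 - x); have := normr_ge0 s; have := normr_ge0 r; lra.
have fK y b : f y = b%:E -> s <= b + K * p (y - x0).
  move=> fy; have [p1|p1] := ltP (p (y - x0)) 1.
    have := fs _ p1; rewrite fy lte_fin => /ltW/le_trans; apply.
    by rewrite lerDl mulr_ge0.
  have := econvex_fun_ge_seminorm y cf fNy sp fx f1; rewrite fy lee_fin.
  have := pD (y - x0) (x0 - x); rewrite addrA subrK => h1 h2.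
  have := p0 (x0 - x); have := ler_norm s.
  have := ler_norm (- r); rewrite normrN => h3 h4 h5.
  have : (K - 2) * 1 <= (K - 2) * p (y - x0).
    by apply: ler_wpM2l => //; rewrite /K; have := normr_ge0 s; have := normr_ge0 r; lra.
  by rewrite /K; lra.
(* A linear form below the sublinear functional inf V is the slope of an affine
   minorant (l = 1, d = y - x0) and is dominated by K * p (l = 0). *)
pose V d := [set a | exists l y b,
  [/\ 0 <= l, f y = b%:E & a = l * (b - s) + K * p (d - l *: (y - x0))]].
have VK d : V d (K * p d).
  by exists 0, x, r; split=> //; rewrite mul0r scale0r subr0 add0r.
have V0 d : V d !=set0 by exists (K * p d).
have Vge d a : V d a -> - (K * p d) <= a.
  move=> [l [y [b [l0 fy ->]]]].
  have := ler_wpM2l l0 (fK _ _ fy).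
  have := ler_wpM2l K0 (pD d (l *: (y - x0) - d)).
  by rewrite subrKC pZ ger0_norm// -[p (_ - d)]pN opprB; lra.
have lV d : has_lbound (V d) by exists (- (K * p d)) => a /Vge.
have pp0 : p 0 = 0 by exact: is_seminorm0.
have /hahn_banach[u uq] : sublinear (fun d => inf (V d)).
  split=> [|d e|t d t0].
  - apply/eqP; rewrite eq_le; apply/andP; split.
      by apply: ge_inf (lV 0) _ _; have := VK 0; rewrite pp0 mulr0.
    by apply: lb_le_inf => // a /Vge; rewrite pp0 mulr0 oppr0.
  - apply: inf_leD => // _ _ [l [y [b [l0 fy ->]]]] [k [z [c [k0 fz ->]]]].
    (* Convexity concerns weights strictly between 0 and 1, so zero weights are treated apart.
       Otherwise the two points merge into [w = (l y + k z) / (l + k)], with weight [l + k]. *)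
    have [l00|ln0] := eqVneq l 0.
      exists (k * (c - s) + K * p (d + e - k *: (z - x0))); first by exists k, z, c.
      have := ler_wpM2l K0 (pD d (e - k *: (z - x0))).
      by rewrite l00 scale0r subr0 mul0r addrA; lra.
    have [k00|kn0] := eqVneq k 0.
      exists (l * (b - s) + K * p (d + e - l *: (y - x0))); first by exists l, y, b.
      have := ler_wpM2l K0 (pD (d - l *: (y - x0)) e).
      by rewrite k00 scale0r subr0 mul0r (addrAC d); lra.
    have {}l0 : 0 < l by rewrite lt_neqAle eq_sym ln0.
    have {}k0 : 0 < k by rewrite lt_neqAle eq_sym kn0.
    have lk0 : 0 < l + k by exact: addr_gt0.
    pose t := l / (l + k).
    have t1 : 1 - t = k / (l + k) by rewrite /t; field; rewrite gt_eqF.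
    have [|a fa ale] := econvex_fun_fin cf fNy fy fz (t := t).
      by rewrite divr_gt0//= -subr_gt0 t1 divr_gt0.
    set w := t *: y + (1 - t) *: z in fa.
    exists ((l + k) * (a - s) + K * p (d + e - (l + k) *: (w - x0))).
      by exists (l + k), w, a; split=> //; exact: ltW.
    have -> : (l + k) *: (w - x0) = l *: (y - x0) + k *: (z - x0).
      rewrite !scalerBr /w scalerDr !scalerA t1 /t !mulrA.
      rewrite ![(l + k) * _]mulrC !mulfK ?gt_eqF// scalerDl opprD.
      by rewrite addrACA.
    rewrite opprD addrACA.
    have := ler_wpM2l K0 (pD (d - l *: (y - x0)) (e - k *: (z - x0))).
    have := ler_wpM2l (ltW lk0) ale.
    have -> : (l + k) * (t * b + (1 - t) * c) = l * b + k * c.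
      by rewrite t1 /t; field; rewrite gt_eqF.
    by lra.
  - apply: inf_leM => // _ [l [y [b [l0 fy ->]]]].
    exists ((t * l) * (b - s) + K * p (t *: d - (t * l) *: (y - x0))).
      by exists (t * l), y, b; split=> //; rewrite mulr_ge0// ltW.
    by rewrite -scalerA -scalerBr pZ gtr0_norm//; lra.
have uK d : u d <= K * p d by apply: le_trans (uq d) _; apply: ge_inf (lV d) _ _.
exists u, K; split=> [d|y].
  by rewrite ler_norml uK andbT lerNl -linearN (le_trans (uK _))// pN.
case fy: (f y) => [b| |]; last 2 first.
- by rewrite leey.
- by have := fNy y; rewrite fy.
rewrite lee_fin -lerBrDr (le_trans (uq _))//.
apply: ge_inf (lV _) _ _; exists 1, y, b; split=> //.
by rewrite scale1r subrr pp0 mulr0 addr0 mul1r.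
Qed.

End affine_minorant.

(** * The dual space and the weak-* topology *)

Section dual.
Context {R : realType} {X : normedModType R}.
Implicit Types (u v w : continuous_dual X) (x y : X).

Lemma dual_linear u : linear (u : X -> R^o).
Proof. by have /asboolP[] := valP u. Qed.

HB.instance Definition _ u :=
  GRing.isLinear.Build R X R^o _ (dual_fun u) (dual_linear u).

Lemma dual_continuous u : continuous (u : X -> R^o).
Proof. by have /asboolP[] := valP u. Qed.

Lemma dual_add u x y : u (x + y) = u x + u y.
Proof. exact: linearD. Qed.

Lemma dual_scale u a x : u (a *: x) = a * u x.
Proof. exact: linearZ. Qed.

Lemma dual0 u : u 0 = 0.
Proof. exact: linear0. Qed.

Lemma dualDE u v x : (u + v) x = u x + v x.
Proof. by []. Qed.

Lemma dualZE a u x : (a *: u) x = a * u x.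
Proof. by []. Qed.

Lemma dualBE u v x : (u - v) x = u x - v x.
Proof. by []. Qed.

Lemma dual_ext u v : u =1 v -> u = v.
Proof. by move=> uv; apply/val_inj/funext. Qed.

Lemma continuous_dual_of_linear (u : {linear X -> R^o}) : continuous u ->
  exists v : continuous_dual X, v =1 u.
Proof.
move=> cu; have uin : (u : X -> R^o) \in @continuous_linear_form R X.
  by apply/asboolP; split => //; exact: linearP.
by exists (ContinuousDual uin).
Qed.

Lemma continuous_dual_of_bounded (u : {linear X -> R^o}) K :
  (forall x, `|u x| <= K * `|x|) -> exists v : continuous_dual X, v =1 u.
Proof.
move=> uK; apply: continuous_dual_of_linear.
apply/linear_bounded_continuous/linear_boundedP; near=> r => x.
by rewrite (le_trans (uK x))// ler_wpM2r.
Unshelve. all: by end_near. Qed.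

Lemma dual_bounded u : exists2 K, 0 < K & forall x, `|u x| <= K * `|x|.
Proof.
have /linear_bounded_continuous/linear_boundedP ub := @dual_continuous u.
near (+oo : set_system R) => K; exists K; first by [].
by near: K.
Unshelve. all: by end_near. Qed.

(** Lower semicontinuity at a point of the domain and at [x] gives two balls; the norm divided by
    the smaller radius is a seminorm that fits [seminorm_affine_minorant]. The slope it dominates is
    continuous. *)
Theorem affine_minorant (f : X -> \bar R) x s : convex_lsc X f ->
  (s%:E < f x)%E ->
  exists u a, (forall y, ((u y + a)%:E <= f y)%E) /\ u x + a = s.
Proof.
move=> [[fNy [x0 fx0]] cf lf] sfx.
case fx0E: (f x0) => [r| |]; last 2 first.
- by rewrite fx0E eqxx in fx0.
- by have := fNy x0; rewrite fx0E.
have [|V1 /nbhs_normP[e1 /= e10 V1e] V1f] := lf x0 (r - 1).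
  by rewrite fx0E lte_fin ltrBlDr ltrDl.
have [V2 /nbhs_normP[e2 /= e20 V2e] V2f] := lf _ _ sfx.
pose e := Num.min e1 e2; have e0 : 0 < e by rewrite lt_min e10.
pose p (y : X) := e^-1 * `|y|.
have sp : is_seminorm p.
  split=> [y z|a y]; last by rewrite /p normrZ mulrCA.
  by rewrite /p -mulrDr ler_pM2l ?invr_gt0// ler_normD.
have pe y z : p (y - z) < 1 -> `|z - y| < e.
  by rewrite /p mulrC ltr_pdivrMr// mul1r distrC.
have [||u [K [uK uf]]] := seminorm_affine_minorant (x0 := x) (s := s) cf fNy sp fx0E.
- move=> z /pe ze; apply/V1f/V1e => /=; rewrite (lt_le_trans ze)//.
  by rewrite ge_min lexx.
- move=> z /pe ze; apply/V2f/V2e => /=; rewrite (lt_le_trans ze)//.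
  by rewrite ge_min lexx orbT.
have [|v vu] := @continuous_dual_of_bounded u (K * e^-1).
  by move=> y; rewrite -mulrA.
exists v, (s - v x); split=> [y|]; last by rewrite subrKC.
by rewrite !vu addrCA -linearB addrC.
Qed.

(** The sets with the stated property form a filter converging pointwise to [w], so this filter
    contains every weak-* neighbourhood. *)
Lemma nbhs_weak_star (w : weak_star X) (V : set (weak_star X)) : nbhs w V ->
  exists (s : seq X) (e : R), 0 < e /\
    forall u : continuous_dual X,
      \sum_(x <- s) `|(u - (w : continuous_dual X)) x| < e -> V u.
Proof.
pose F : set_system (continuous_dual X) := [set A | exists (s : seq X) (e : R),
  0 < e /\ forall u, \sum_(x <- s) `|(u - (w : continuous_dual X)) x| < e -> A u].
have FF : Filter F.
  split.
  - by exists [::], 1.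
  - move=> A B [s [e [e0 sA]]] [t [d [d0 tB]]].
    exists (s ++ t), (Num.min e d); split; first by rewrite lt_min e0.
    move=> u; rewrite big_cat/= lt_min => /andP[ue ud].
    split; [apply: sA|apply: tB].
      by apply: le_lt_trans ue; rewrite lerDl sumr_ge0.
    by apply: le_lt_trans ud; rewrite lerDr sumr_ge0.
  - by move=> A B AB [s [e [e0 sA]]]; exists s, e; split=> // u /sA/AB.
suff Fw : {ptws, ((@dual_fun R X : continuous_dual X -> X -> R^o) @ F) -->
    @dual_fun R X w}.
  move=> [_ [[B Bop <-] Bfw BV]].
  have /Fw [s [e [e0 sB]]] : nbhs (@dual_fun R X w : {ptws X -> R^o}) B.
    by rewrite nbhsE; exists B.
  by exists s, e; split=> // u /sB/BV.
apply/pointwise_cvgP => x.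
apply/cvgrPdist_lt => e e0; exists [:: x], e; split=> // u.
by rewrite big_seq1 distrC.
Qed.

(** Induction on [s]. If some form vanishes on the tail but not at [z], normalise it to [v] with
    [v z = 1] and subtract [U v] times the evaluation at [z] from [U]; otherwise [z] is
    redundant. *)
Lemma linear_vanishing_evaluation (s : seq X) (U : continuous_dual X -> R^o) :
  linear U -> (forall u, (forall x, x \in s -> u x = 0) -> U u = 0) ->
  exists x, forall u, U u = u x.
Proof.
elim: s U => [|z s IH] U lU Us.
  by exists 0 => u; rewrite linear0 Us.
have [[u0 u0s u0z]|nu0] := pselect (exists2 u : continuous_dual X,
  (forall x, x \in s -> u x = 0) & u z != 0).
  pose v := (u0 z)^-1 *: u0.
  have vz : v z = 1 by rewrite dualZE mulVf.
  have vs x : x \in s -> v x = 0 by move=> /u0s h; rewrite dualZE h mulr0.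
  have [||x Ux] := IH (fun u => U u - U v * u z).
  - move=> a u u'; have uz : (a *: u + u') z = a * u z + u' z by [].
    by rewrite lU uz /GRing.scale/=; ring.
  - move=> u us; have : U (- u z *: v + u) = 0.
      apply: Us => x; rewrite inE => /predU1P[->|xs].
        by rewrite dualDE dualZE vz mulr1 addNr.
      by rewrite dualDE dualZE (vs _ xs) (us _ xs) mulr0 addr0.
    by rewrite lU /GRing.scale/=; lra.
  exists (x + U v *: z) => u; rewrite linearD linearZ/= -Ux.
  by rewrite /GRing.scale/= subrK.
apply: IH => // u us; apply: Us => x; rewrite inE => /predU1P[->|/us//].
by apply/eqP; apply: contrapT => /negP uz; apply: nu0; exists u.
Qed.

(** As on [X], with a seminorm built from finitely many evaluations. The slope obtained vanishes
    wherever these do, hence is itself an evaluation. *)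
Theorem weak_star_affine_minorant (g : continuous_dual X -> \bar R) u s :
  convex_wstar_lsc X g -> (s%:E < g u)%E ->
  exists x a, (forall v, ((v x + a)%:E <= g v)%E) /\ u x + a = s.
Proof.
move=> [[gNy [u0 gu0]] cg lg] sgu.
case gu0E: (g u0) => [r| |]; last 2 first.
- by rewrite gu0E eqxx in gu0.
- by have := gNy u0; rewrite gu0E.
have [|V1 /nbhs_weak_star[s1 [e1 [e10 V1e]]] V1g] := lg u0 (r - 1).
  by rewrite gu0E lte_fin ltrBlDr ltrDl.
have [V2 /nbhs_weak_star[s2 [e2 [e20 V2e]]] V2g] := lg _ _ sgu.
pose e := Num.min e1 e2; have e0 : 0 < e by rewrite lt_min e10.
pose q (v : continuous_dual X) := \sum_(x <- s1 ++ s2) `|v x|.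
pose p v := e^-1 * q v.
have sp : is_seminorm p.
  split=> [v w|a v]; rewrite /p /q.
    rewrite -mulrDr ler_pM2l ?invr_gt0// -big_split/= ler_sum// => x _.
    exact: ler_normD.
  rewrite mulrCA; congr (_ * _); rewrite mulr_sumr.
  by apply: eq_bigr => x _; rewrite dualZE normrM.
have pe v w : p (v - w) < 1 -> q (v - w) < e.
  by rewrite /p mulrC ltr_pdivrMr// mul1r.
have [||U [K [UK Ug]]] := seminorm_affine_minorant (x0 := u) (s := s) cg gNy sp gu0E.
- move=> z /pe ze; apply/V1g/V1e; apply: (le_lt_trans (y := q (z - u0))).
    by rewrite /q big_cat/= lerDl sumr_ge0.
  by rewrite (lt_le_trans ze)// ge_min lexx.
- move=> z /pe ze; apply/V2g/V2e; apply: (le_lt_trans (y := q (z - u))).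
    by rewrite /q big_cat/= lerDr sumr_ge0.
  by rewrite (lt_le_trans ze)// ge_min lexx orbT.
have [|v vs|x Ux] := @linear_vanishing_evaluation (s1 ++ s2) U.
- exact: linearP.
- apply/eqP; rewrite -normr_le0 (le_trans (UK v))// /p /q big_seq big1 ?mulr0//.
  by move=> x xs; rewrite vs// normr0.
exists x, (s - u x); split=> [v|]; last by rewrite subrKC.
by rewrite -!Ux addrCA -linearB addrC.
Qed.

End dual.

(** * Point functions and affine functions *)

Local Open Scope ereal_scope.

Section point_function.
Context {R : realType} {E : lmodType R}.
Implicit Types (f g h : E -> \bar R) (p x y : E) (r : R).

Definition point_fun p r : E -> \bar R :=
  fun x => if x == p then r%:E else +oo.

Lemma point_fun_proper p r : proper_fun (point_fun p r).
Proof.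
split=> [x|]; first by rewrite /point_fun; case: ifP.
by exists p; rewrite /point_fun eqxx.
Qed.

Lemma le_point_fun f p r : (forall x, f x <= point_fun p r x) <-> f p <= r%:E.
Proof.
split=> [/(_ p)|fp x]; rewrite /point_fun ?eqxx//.
by case: eqP => [->|]; rewrite ?leey.
Qed.

Lemma point_fun_inj p q r s :
  point_fun p r = point_fun q s -> p = q /\ r = s.
Proof.
move=> pq; have : point_fun p r p = point_fun q s p by rewrite pq.
by rewrite /point_fun eqxx; case: (eqVneq p q) => [-> [->]|].
Qed.

Lemma point_fun_econvex p r : econvex_fun (point_fun p r).
Proof.
move=> x y t /andP[t0 t1]; rewrite /point_fun.
have t1' : (0 < 1 - t)%R by rewrite subr_gt0.
case: (eqVneq x p) => [->|_]; case: (eqVneq y p) => [->|_].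
- by rewrite -scalerDl subrKC scale1r eqxx -!EFinM -EFinD lee_fin -mulrDl subrKC mul1r.
- by rewrite [X in _ + X]gt0_muley ?lte_fin// -EFinM addey ?leey.
- by rewrite gt0_muley ?lte_fin// -EFinM addye ?leey.
- by rewrite !gt0_muley ?lte_fin// leey.
Qed.

Lemma ge_point_fun_total p r g h :
  (forall x, point_fun p r x <= g x) -> (forall x, point_fun p r x <= h x) ->
  (forall x, g x <= h x) \/ (forall x, h x <= g x).
Proof.
move=> pg ph; have gh f : (forall x, point_fun p r x <= f x) ->
    forall x, x != p -> f x = +oo.
  move=> pf x /negPf xp; apply/eqP; rewrite -leye_eq.
  by have := pf x; rewrite /point_fun xp.
have [le_gh|/ltW le_hg] := leP (g p) (h p); [left|right] => x.
all: by have [->|xp] := eqVneq x p => //; rewrite !gh.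
Qed.

(** If [f] were finite at two points, the point functions there would be incomparable majorants. *)
Lemma point_fun_of_total (P : set (E -> \bar R)) f :
  (forall p r, P (point_fun p r)) -> proper_fun f ->
  (forall g h, P g -> P h -> (forall x, f x <= g x) -> (forall x, f x <= h x) ->
    (forall x, g x <= h x) \/ (forall x, h x <= g x)) ->
  exists p r, f = point_fun p r.
Proof.
move=> Pp [fNy [p fp]] ftot.
have fin x : f x != +oo -> exists r, f x = r%:E.
  by have := fNy x; case: (f x) => // r _ _; exists r.
have [r fr] := fin p fp; exists p, r; apply/funext => x; rewrite /point_fun.
case: eqVneq => [->//|xp]; apply/eqP; apply: contrapT => /negP fx.
have [s fs] := fin x fx.
case: (ftot (point_fun p r) (point_fun x s)) => //.
- by apply/le_point_fun; rewrite fr.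
- by apply/le_point_fun; rewrite fs.
- by move/(_ x); rewrite /point_fun eqxx (negPf xp).
- by move/(_ p); rewrite /point_fun eqxx eq_sym (negPf xp).
Qed.

End point_function.

Lemma lower_semicontinuous_point (R : realType) (T : topologicalType)
    (f : T -> \bar R) p : (forall x, x <> p -> f x = +oo) ->
  (forall x, x <> p -> nbhs x [set y | y <> p]) -> lower_semicontinuous f.
Proof.
move=> fy pnbhs x a afx.
have [xp|xp] := pselect (x = p); last first.
  by exists [set y | y <> p]; [exact: pnbhs|move=> y /fy->; exact: ltry].
exists setT => [|y _]; first exact: filterT.
by have [->|/fy->] := pselect (y = p); rewrite ?ltry// -xp.
Qed.

Lemma lower_semicontinuous_EFin (R : realType) (T : topologicalType)
    (h : T -> R^o) : continuous h -> lower_semicontinuous (fun x => (h x)%:E).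
Proof.
move=> ch x a; rewrite lte_fin => ahx.
exists (h @^-1` [set z | a < z]%R) => [|y/=]; last by rewrite lte_fin.
exact: (ch x _ (lt_nbhsr ahx)).
Qed.

Lemma EFin_lt_dense (R : realType) (a : R) (e : \bar R) : a%:E < e ->
  exists2 s, (a < s)%R & s%:E < e.
Proof.
case: e => [b| |//]; last by exists (a + 1)%R; rewrite ?ltrDl ?ltry.
by rewrite lte_fin => ab; exists ((a + b) / 2)%R; rewrite ?lte_fin; lra.
Qed.

Section affine_function.
Context {R : realType} {E : lmodType R}.
Implicit Types (l k : {linear E -> R^o}) (a b c : R).

Lemma affine_econvex l a : econvex_fun (fun x => (l x + a)%:E).
Proof.
move=> x y t _; rewrite -!EFinM -EFinD lee_fin linearD !linearZ/=.
by rewrite le_eqVlt /GRing.scale/=; apply/orP; left; apply/eqP; ring.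
Qed.

Lemma affine_proper l a : proper_fun (fun x => (l x + a)%:E).
Proof. by split=> //; exists 0%R. Qed.

Lemma ler_onem_mul (b a : R) :
  (forall t, 0 < t < 1 -> b <= (1 - t) * a)%R -> (b <= a)%R.
Proof.
move=> ba; rewrite leNgt; apply/negP => ab.
have a0 : (a < 0)%R by have := ba 2^-1%R; lra.
have b0 : (b <= 0)%R by have := ba 2^-1%R; lra.
(* With this [t], [(1 - t) * a] is the midpoint of [a] and [b], which is below [b]. *)
pose t := ((b - a) / (2 * - a))%R.
have ta : (t * a = (a - b) / 2)%R by rewrite /t; field; rewrite lt_eqF.
have t0 : (0 < t)%R by rewrite divr_gt0 ?subr_gt0// mulr_gt0// oppr_gt0.
have t1 : (t < 1)%R by rewrite ltr_pdivrMr ?mulr_gt0 ?oppr_gt0//; lra.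
by have := ba t; rewrite t0 t1 mulrBl ta => /(_ isT); lra.
Qed.

(** [f - l] is convex and bounded above on the whole space, hence constant. *)
Lemma econvex_le_affine (f : E -> \bar R) l a : (forall x, f x != -oo) ->
  econvex_fun f -> (forall x, f x <= (l x + a)%:E) ->
  exists c, forall x, f x = (l x + c)%:E.
Proof.
move=> fNy cf fl.
have fin x : f x = (fine (f x))%:E.
  by rewrite fineK// fin_numE fNy -ltey (le_lt_trans (fl x)) ?ltry.
pose d x := (fine (f x) - l x - a)%R.
have d0 x : (d x <= 0)%R.
  by have := fl x; rewrite fin lee_fin /d; lra.
have dle x y : (d y <= d x)%R.
  apply: ler_onem_mul => t t01; have /andP[t0 t1] := t01.
  (* y lies between x and z, and d z <= 0; here z escapes to infinity as t tends
     to 0. *)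
  pose z := (x + t^-1 *: (y - x))%R.
  have yE : (t *: z + (1 - t) *: x = y)%R.
    rewrite /z scalerDr scalerA mulfV ?gt_eqF// scale1r addrAC -scalerDl.
    by rewrite subrKC scale1r subrKC.
  have := cf z x t t01; rewrite yE (fin y) (fin z) (fin x) -!EFinM -EFinD lee_fin.
  have : (l y = t * l z + (1 - t) * l x)%R by rewrite -[in LHS]yE linearD !linearZ.
  have : (0 <= t * - d z)%R by rewrite mulr_ge0 ?oppr_ge0// ltW.
  by rewrite /d; lra.
exists (d 0 + a)%R => x; rewrite fin; congr (_%:E).
by have := dle 0%R x; have := dle x 0%R; rewrite /d; lra.
Qed.

Lemma le_affine_slope l k a b : (forall x, l x + a <= k x + b)%R -> l =1 k.
Proof.
move=> lk x; have [c lc] : exists c, forall x, (l x + a)%:E = (k x + c)%:E.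
  apply: (@econvex_le_affine (fun x => (l x + a)%:E) k b) => //.
  exact: affine_econvex.
by have [] := lc x; have [] := lc 0%R; rewrite !linear0; lra.
Qed.

(** The family [l] stands for the dual of [X] or for the evaluations on it. Comparable affine
    functions are parallel, so all minorants share one slope. A minorant rising above the parallel
    function through [(x0, f x0)] would exceed [f] at [x0]; so [f] lies below that function, and
    [econvex_le_affine] applies. *)
Lemma affine_of_total (I : Type) (l : I -> {linear E -> R^o}) (f : E -> \bar R) :
  proper_fun f -> econvex_fun f ->
  (forall x s, s%:E < f x ->
    exists i a, (forall y, (l i y + a)%:E <= f y) /\ (l i x + a)%R = s) ->
  (forall i j a b, (forall y, (l i y + a)%:E <= f y) ->
    (forall y, (l j y + b)%:E <= f y) ->
    (forall y, l i y + a <= l j y + b)%R \/ (forall y, l j y + b <= l i y + a)%R) ->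
  exists i c, forall x, f x = (l i x + c)%:E.
Proof.
move=> [fNy [x0 fx0]] cf fmin ftot.
case fx0E: (f x0) => [r| |]; last 2 first.
- by rewrite fx0E eqxx in fx0.
- by have := fNy x0; rewrite fx0E.
have [|i [a [ia _]]] := fmin x0 (r - 1)%R.
  by rewrite fx0E lte_fin; lra.
have [|c fc] := @econvex_le_affine f (l i) (r - l i x0)%R fNy cf.
  move=> y; rewrite leNgt; apply/negP => /EFin_lt_dense[s + /fmin[j [b [jb jy]]]].
  have ij : l i =1 l j.
    by case: (ftot _ _ _ _ ia jb) => /le_affine_slope // ji x; rewrite ji.
  have := jb x0; rewrite fx0E lee_fin -ij; move: jy; rewrite -ij; lra.
by exists i, c.
Qed.

End affine_function.

(** * Membership in the two classes, and norming functionals *)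

Section classes.
Context {R : realType} {X : normedModType R}.
Implicit Types (u v w : continuous_dual X) (x y : X) (a b r s : R).

Definition evaluation_fun x (u : continuous_dual X) : R^o := u x.

Lemma evaluation_linear x : linear (evaluation_fun x).
Proof. by []. Qed.

HB.instance Definition _ x :=
  GRing.isLinear.Build R (continuous_dual X) R^o _ (evaluation_fun x)
    (evaluation_linear x).

Lemma evaluation_continuous x :
  continuous (evaluation_fun x : weak_star X -> R^o).
Proof.
move=> u; apply: (@continuous_comp _ _ _ (@dual_fun R X : weak_star X -> {ptws X -> R^o})
  (fun f : {ptws X -> R^o} => f x)).
  exact: initial_continuous.
exact: (@proj_continuous X (fun=> R^o) x).
Qed.

Lemma affine_convex_lsc u a : convex_lsc X (fun x => (u x + a)%:E).
Proof.
split; [exact: affine_proper|exact: affine_econvex|].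
apply: (@lower_semicontinuous_EFin _ _ (fun x => u x + a)%R) => x.
by apply: cvgD; [exact: dual_continuous|exact: cvg_cst].
Qed.

Lemma point_convex_lsc x r : convex_lsc X (point_fun x r).
Proof.
split; [exact: point_fun_proper|exact: point_fun_econvex|].
apply: (@lower_semicontinuous_point _ _ _ x) => y /eqP yx.
  by rewrite /point_fun (negPf yx).
apply: open_nbhs_nbhs; split; last exact/eqP.
rewrite (_ : [set _ | _] = ~` [set x])//.
exact/closed_openC/accessible_closed_set1/hausdorff_accessible/norm_hausdorff.
Qed.

Lemma affine_convex_wstar_lsc x a : convex_wstar_lsc X (fun u => (u x + a)%:E).
Proof.
split; [exact: (affine_proper (evaluation_fun x))|
  exact: (affine_econvex (evaluation_fun x))|].
apply: (@lower_semicontinuous_EFin _ _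
  (fun u : weak_star X => evaluation_fun x u + a)%R) => u.
exact: (cvgD (@evaluation_continuous x u) (cvg_cst a)).
Qed.

Lemma point_convex_wstar_lsc u r : convex_wstar_lsc X (point_fun u r).
Proof.
split; [exact: point_fun_proper|exact: point_fun_econvex|].
apply: (@lower_semicontinuous_point _ (weak_star X) _ u) => v vu.
  by rewrite /point_fun; case: eqP.
have [x vx] : exists x, (v : continuous_dual X) x <> u x.
  by apply/existsNP => uv; apply: vu; exact: dual_ext.
have vnbhs : nbhs (evaluation_fun x v) (~` [set u x]).
  by apply: open_nbhs_nbhs; split => //; exact/closed_openC/closed_eq.
have := evaluation_continuous vnbhs; rewrite nbhs_simpl/=.
by apply: filterS => w /= wx wu; apply: wx; rewrite wu.
Qed.

Lemma norm_convex_lsc : convex_lsc X (fun x => `|x|%:E).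
Proof.
split; first by split=> //; exists 0%R.
  move=> x y t /andP[t0 t1]; rewrite -!EFinM -EFinD lee_fin.
  rewrite (le_trans (ler_normD _ _))// !normrZ !gtr0_norm ?subr_gt0//.
exact: (@lower_semicontinuous_EFin _ _ (@Num.norm R X) (@norm_continuous _ _)).
Qed.

(** An affine minorant of the norm with value [s] at [x] has a nonpositive constant term, and a
    slope of norm at most 1, since otherwise it would overtake the norm along a ray. *)
Lemma norming_dual x s : (s < `|x|)%R ->
  exists w, (forall y, `|w y| <= `|y|)%R /\ (s <= w x)%R.
Proof.
move=> sx; have [|w [a [wa wx]]] := @affine_minorant _ _ _ x s norm_convex_lsc.
  by rewrite lte_fin.
have wy y : (w y <= `|y|)%R.
  rewrite leNgt; apply/negP => yw.
  pose t := ((1 + `|a|) / (w y - `|y|))%R.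
  have t0 : (0 < t)%R by rewrite divr_gt0 ?subr_gt0// ltr_pwDl.
  have := wa (t *: y)%R; rewrite lee_fin normrZ gtr0_norm// linearZ/= => h.
  have : (t * (w y - `|y|) = 1 + `|a|)%R by rewrite /t mulfVK// gt_eqF ?subr_gt0.
  by have := ler_norm (- a)%R; rewrite normrN; move: h; rewrite /GRing.scale/=; lra.
exists w; split=> [y|].
  by rewrite ler_norml wy andbT lerNl -linearN (le_trans (wy _))// normrN.
by have := wa 0%R; rewrite linear0 normr0 lee_fin; lra.
Qed.

Lemma dual_separates x y : (forall w, w x = w y) -> x = y.
Proof.
move=> xy; apply/eqP; rewrite -subr_eq0 -normr_le0 leNgt; apply/negP => xy0.
have [|w [_]] := @norming_dual (x - y)%R (`|x - y| / 2)%R; first by lra.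
by rewrite linearB/= xy subrr; lra.
Qed.

End classes.

(** * Recognising affine functions by the order *)

Section chains.
Context {R : realType} {X : normedModType R}.

Definition total_set (T : Type) (P : set (T -> \bar R)) :=
  forall g h, P g -> P h ->
    (forall x, g x <= h x) \/ (forall x, h x <= g x).

Lemma affine_of_total_lsc (f : X -> \bar R) : convex_lsc X f ->
  total_set [set g | convex_lsc X g /\ forall x, g x <= f x] ->
  exists (u : continuous_dual X) a, f = (fun x => (u x + a)%:E).
Proof.
move=> Cf ftot; have [pf cf _] := Cf.
have [|i j a b ia jb|u [a fu]] := @affine_of_total R X (continuous_dual X) id f pf cf.
- by move=> x s; exact: affine_minorant.
- have [||ij|ij] := ftot (fun y => (i y + a)%:E) (fun y => (j y + b)%:E).
  + by split=> //; exact: affine_convex_lsc.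
  + by split=> //; exact: affine_convex_lsc.
  + by left=> y; have := ij y; rewrite lee_fin.
  + by right=> y; have := ij y; rewrite lee_fin.
- by exists u, a; apply/funext.
Qed.

Lemma affine_of_total_wstar_lsc (g : continuous_dual X -> \bar R) :
  convex_wstar_lsc X g ->
  total_set [set h | convex_wstar_lsc X h /\ forall u, h u <= g u] ->
  exists x a, g = (fun u => (u x + a)%:E).
Proof.
move=> Cg gtot; have [pg cg _] := Cg.
have [|x y a b xa yb|x [a gx]] :=
    @affine_of_total R _ X (@evaluation_fun R X) g pg cg.
- by move=> u s; exact: weak_star_affine_minorant.
- have [||xy|xy] := gtot (fun u => (u x + a)%:E) (fun u => (u y + b)%:E).
  + by split=> //; exact: affine_convex_wstar_lsc.
  + by split=> //; exact: affine_convex_wstar_lsc.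
  + by left=> u; have := xy u; rewrite lee_fin.
  + by right=> u; have := xy u; rewrite lee_fin.
- by exists x, a; apply/funext.
Qed.

Lemma total_le_affine (E : lmodType R) (l : {linear E -> R^o}) (a : R) :
  total_set [set g : E -> \bar R | (proper_fun g /\ econvex_fun g) /\
    forall x, g x <= (l x + a)%:E].
Proof.
move=> g h [[[gNy _] cg] gl] [[[hNy _] ch] hl].
have [c gc] := econvex_le_affine gNy cg gl; have [d hd] := econvex_le_affine hNy ch hl.
have [cd|/ltW dc] := leP c d; [left|right] => x.
all: by rewrite gc hd lee_fin lerD2l.
Qed.

End chains.

Local Close Scope ereal_scope.

(** * The pairing equation *)

(** If [k <= n t < k + 1], monotonicity puts [n g(t)] between [k g(1)] and [(k + 1) g(1)], where
    [n t g(1)] lies too. Thus [n |g(t) - t g(1)| <= g(1)] for all [n]. *)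
Lemma nondecreasing_additive (R : realType) (g : R -> R) :
  (forall s t, g (s + t) = g s + g t) -> {homo g : s t / s <= t} ->
  forall t, g t = t * g 1.
Proof.
move=> gD gm.
have g0 : g 0 = 0 by have := gD 0 0; rewrite addr0; lra.
have gN s : g (- s) = - g s by have := gD s (- s); rewrite subrr g0; lra.
have gn s n : g (n%:R * s) = n%:R * g s.
  elim: n => [|n IH]; first by rewrite !mul0r.
  by rewrite -natr1 !mulrDl !mul1r gD IH.
have g1 : 0 <= g 1 by rewrite -g0 gm.
suff gpos t : 0 <= t -> g t = t * g 1.
  move=> t; have [/gpos//|t0] := leP 0 t.
  by have := gpos (- t); rewrite gN mulNr oppr_ge0 ltW// => /(_ isT)/oppr_inj.
move=> t0.
have bound n : n%:R * `|g t - t * g 1| <= g 1.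
  have nt0 : 0 <= n%:R * t by rewrite mulr_ge0.
  have /andP[km mk] := truncn_itv nt0; set k := Num.truncn _ in km mk.
  have := gm _ _ km; have := gm _ _ (ltW mk).
  rewrite -[k%:R]mulr1 -[k.+1%:R]mulr1 !gn -[n%:R]ger0_norm// -normrM ler_norml.
  rewrite ger0_norm// => h1 h2.
  have := ler_wpM2r g1 km; have := ler_wpM2r g1 (ltW mk).
  by move: h1; rewrite -natr1 !mulrBr !mulrDl !mul1r !mulrA; lra.
apply/eqP; rewrite -subr_eq0 -normr_le0 leNgt; apply/negP => d0.
have := bound (Num.truncn (g 1 / `|g t - t * g 1|)).+1.
by rewrite leNgt -ltr_pdivrMr// truncnS_gt.
Qed.

Section pairing.
Context {R : realType}.

(* The hypothesis expresses phi u (theta x) as a difference of values that must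
   not depend on a; after moving x0 and u0 (where theta and phi vanish) to the
   origin, it becomes phi u (theta z) = b c - b (c + u z) for all c, which makes
   b affine. *)
Lemma pairing_equation (X : normedModType R) (X_neq0 : exists x : X, x != 0)
    (phi : continuous_dual X -> continuous_dual X) (theta : X -> X)
    (sigma : continuous_dual X -> R -> R) (beta : X -> R -> R) :
  (forall w, exists u, phi u = w) -> (forall y, exists x, theta x = y) ->
  (forall u, {homo sigma u : a b / a <= b >-> b <= a}) ->
  (forall u, injective (sigma u)) ->
  (forall u x a, phi u (theta x) + beta x (u x + a) = sigma u a) ->
  exists u0 x0 tau b0, [/\ 0 < tau,
    forall u z, phi (u0 + u) (theta (x0 + z)) = tau * u z &
    forall u a, sigma u a = b0 - tau * (u x0 + a)].
Proof.
move=> phi_surj theta_surj sigma_anti sigma_inj eqn.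
have [x0 x00] := theta_surj 0; have [u0 u00] := phi_surj 0.
pose b := sigma 0.
have bE u a : sigma u a = b (u x0 + a).
  by rewrite /b -!(eqn _ x0) x00 !linear0 !add0r.
(* At [u0] the [phi] term vanishes, which expresses [beta] through [b]. *)
have betaE z c : beta (x0 + z) c = b (c - u0 z).
  have := eqn u0 (x0 + z) (c - u0 (x0 + z)).
  by rewrite u00 add0r subrKC bE dual_add => ->; congr b; lra.
have phiE u z c : phi (u0 + u) (theta (x0 + z)) = b c - b (c + u z).
  have := eqn (u0 + u) (x0 + z) (c - (u0 + u) x0).
  rewrite betaE bE subrKC => <-.
  have -> : (u0 + u) (x0 + z) + (c - (u0 + u) x0) - u0 z = c + u z.
    rewrite dual_add [(u0 + u) z]dualDE.
    by move: ((u0 + u) x0) (u0 z) (u z) => p q r; lra.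
  by rewrite addrK.
have [x xn0] := X_neq0.
have [e [z ez]] : exists (e : continuous_dual X) z, e z = 1.
  have [|e [_ ex]] := @norming_dual R X x (`|x| / 2).
    by rewrite ltr_pdivrMr// ltr_pMr ?normr_gt0//; lra.
  have ex0 : 0 < e x by rewrite (lt_le_trans _ ex)// divr_gt0 ?normr_gt0.
  by exists ((e x)^-1 *: e), x; rewrite dualZE mulVf// gt_eqF.
(* The left-hand side of [phiE] does not involve [c], and [t *: e] takes the value [t] at [z]. So
   [b 0 - b t] is additive in [t], and nondecreasing since [b] is nonincreasing. *)
have bt c t : b c - b (c + t) = b 0 - b t.
  have := phiE (t *: e) z c; have := phiE (t *: e) z 0.
  by rewrite dualZE ez mulr1 add0r => -> ->.
have gE : forall t, b 0 - b t = t * (b 0 - b 1).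
  apply: nondecreasing_additive => [s t|s t st].
    by have := bt s t; lra.
  by rewrite lerD2l lerN2 sigma_anti.
have b1 : b 1 != b 0.
  by apply/eqP => /sigma_inj/eqP; rewrite oner_eq0.
have b10 : b 1 <= b 0 by rewrite sigma_anti.
exists u0, x0, (b 0 - b 1), (b 0); split=> [|u z'|u a].
- by rewrite subr_gt0 lt_neqAle b1.
- by rewrite (phiE _ _ 0) add0r gE mulrC.
- by rewrite bE [_ * (_ + a)]mulrC -gE; lra.
Qed.

(** Rescaling [theta] by [tau^-1] makes the pairing exact. The forms [phi u] exhaust the dual and so
    separate points, which gives linearity; injectivity holds because the forms [u] separate
    points. *)
Lemma pairing_automorphism (X : completeNormedModType R)
    (phi : continuous_dual X -> continuous_dual X) (theta : X -> X) (tau : R) :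
  0 < tau -> (forall w, exists u, phi u = w) ->
  (forall y, exists x, theta x = y) ->
  (forall u z, phi u (theta z) = tau * u z) ->
  exists H : {linear X -> X}, [/\ continuous H, bijective H &
    forall u z, phi u (H z) = u z].
Proof.
move=> tau0 phi_surj theta_surj pt.
pose h z := tau^-1 *: theta z.
have ph u z : phi u (h z) = u z.
  by rewrite /h linearZ/= pt /GRing.scale/= mulKf// gt_eqF.
have lh : linear h.
  move=> a x y; apply: dual_separates => w; have [u <-] := phi_surj w.
  by rewrite linearP/= !ph linearP.
pose H := pack_linear lh.
have H_inj : injective H.
  by move=> x y xy; apply: dual_separates => u; rewrite -(ph u x) -(ph u y);
    congr (phi u _).
have H_surj y : exists x, H x = y.
  have [x xy] := theta_surj (tau *: y); exists x.
  by rewrite /H/= /h xy scalerA mulVf ?scale1r// gt_eqF.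
exists H; split=> //; last first.
  have [g gK] := choice H_surj; exists g => // x; apply: H_inj; exact: gK.
apply/linear_bounded_continuous/bounded_funP => r.
(* The forms phi u of norm at most 1 compose with H to the continuous forms u,
   so the uniform boundedness principle applies to the latter. *)
pose F : set (X -> R^o) :=
  [set dual_fun u | u in [set u | forall y, `|phi u y| <= `|y|]].
have [|x|M MF] := @Banach_Steinhauss R X R^o F _ _ r.
- move=> _ [u _ <-]; split; last exact: dual_linear.
  move=> d; have [K K0 uK] := dual_bounded u; exists (K * d) => x xd.
  by rewrite (le_trans (uK x))// ler_wpM2l// ltW.
- by exists `|h x| => _ [u uF <-]; rewrite -(ph u x).
exists M => x xr; rewrite leNgt; apply/negP => MH.
have [|w [w1]] := @norming_dual R X (H x) ((M + `|H x|) / 2); first by lra.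
have [u uw] := phi_surj w; move: w1; rewrite -uw => u1; rewrite (ph u x) => hx.
have /(MF _)/(_ _ xr) : F u by exists u.
by have := ler_norm (u x); lra.
Qed.

End pairing.

Local Open Scope ereal_scope.

(** * Order reversing operators *)

Section order_reversing.
Context {R : realType} {X : normedModType R}.
Variable S : convex_lsc X -> convex_wstar_lsc X.
Hypothesis S_reversing : fully_order_reversing S.
Implicit Types (u v w : continuous_dual X) (x y : X) (a b r s : R).

Let affineX u a : convex_lsc X := SigSub (mem_set (affine_convex_lsc u a)).
Let pointX x r : convex_lsc X := SigSub (mem_set (point_convex_lsc x r)).
Let affineD x a : convex_wstar_lsc X :=
  SigSub (mem_set (affine_convex_wstar_lsc x a)).
Let pointD u r : convex_wstar_lsc X :=
  SigSub (mem_set (point_convex_wstar_lsc u r)).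

Let S_surj (g : continuous_dual X -> \bar R) : convex_wstar_lsc X g ->
  exists f : convex_lsc X, val (S f) = g.
Proof.
by move=> Cg; have [f fg] := S_reversing.1 (SigSub (mem_set Cg)); exists f; rewrite fg.
Qed.

Let le_S (f g : convex_lsc X) : (forall x, val f x <= val g x) <->
  (forall u, val (S g) u <= val (S f) u).
Proof. exact: S_reversing.2. Qed.

Let class_val (f : convex_lsc X) : convex_lsc X (val f).
Proof. exact: set_valP. Qed.

Let class_valS (f : convex_wstar_lsc X) : convex_wstar_lsc X (val f).
Proof. exact: set_valP. Qed.

(** The majorants of the image are the images of the minorants of the affine function, which form a
    chain; only point functions have this property. The next three lemmas exchange the roles of
    minorants and majorants, or of [S] and its inverse. *)
Lemma image_affine u a : exists w s, S (affineX u a) = pointD w s.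
Proof.
have [|||w [s ws]] :=
    @point_fun_of_total R _ (convex_wstar_lsc X) (val (S (affineX u a))).
- exact: point_convex_wstar_lsc.
- by case: (class_valS (S (affineX u a))).
- move=> g h /S_surj[f <-] /S_surj[k <-] /le_S fa /le_S ka.
  have := @total_le_affine _ _ u a (val f) (val k).
  have [pf cf _] := class_val f; have [pk ck _] := class_val k.
  by move=> /(_ (conj (conj pf cf) fa) (conj (conj pk ck) ka))[] /le_S; [right|left].
- by exists w, s; apply/val_inj.
Qed.

Lemma preimage_point w s : exists u a, S (affineX u a) = pointD w s.
Proof.
have [f Sf] := S_surj (point_convex_wstar_lsc w s).
have [|u [a fua]] := affine_of_total_lsc (class_val f).
  move=> g h [Cg gf] [Ch hf].
  have /le_S := gf : forall x, val (SigSub (mem_set Cg)) x <= val f x.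
  have /le_S := hf : forall x, val (SigSub (mem_set Ch)) x <= val f x.
  rewrite Sf => Sh Sg.
  by have [/le_S|/le_S] := ge_point_fun_total Sg Sh; [right|left].
exists u, a; apply/val_inj; rewrite -[RHS]Sf; congr (val (S _)).
exact/val_inj.
Qed.

Lemma image_point x r : exists y b, S (pointX x r) = affineD y b.
Proof.
have [|y [b Syb]] := affine_of_total_wstar_lsc (class_valS (S (pointX x r))).
  move=> g h [/S_surj[f <-] /le_S fx] [/S_surj[k <-] /le_S kx].
  by have [/le_S|/le_S] := ge_point_fun_total fx kx; [right|left].
by exists y, b; apply/val_inj.
Qed.

Lemma preimage_affine y b : exists x r, S (pointX x r) = affineD y b.
Proof.
have [f Sf] := S_surj (affine_convex_wstar_lsc y b).
have [|||x [r fxr]] := @point_fun_of_total R _ (convex_lsc X) (val f).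
- exact: point_convex_lsc.
- by case: (class_val f).
- move=> g h Cg Ch gf hf.
  have /le_S := gf : forall x, val f x <= val (SigSub (mem_set Cg)) x.
  have /le_S := hf : forall x, val f x <= val (SigSub (mem_set Ch)) x.
  rewrite Sf => Sh Sg.
  have [pg cg _] := class_valS (S (SigSub (mem_set Cg))).
  have [ph ch _] := class_valS (S (SigSub (mem_set Ch))).
  by have [/le_S|/le_S] := @total_le_affine _ _ (evaluation_fun y) b _ _
    (conj (conj pg cg) Sg) (conj (conj ph ch) Sh); [right|left].
exists x, r; apply/val_inj; rewrite -[RHS]Sf; congr (val (S _)).
exact/val_inj.
Qed.

Lemma le_affineX u a v b :
  (forall x, val (affineX u a) x <= val (affineX v b) x) -> u = v /\ (a <= b)%R.
Proof.
move=> uv; have uvR x : (u x + a <= v x + b)%R by have := uv x; rewrite lee_fin.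
split; first by apply: dual_ext; exact: le_affine_slope uvR.
by have := uvR 0%R; rewrite !dual0 !add0r.
Qed.

Lemma le_pointD u s v r :
  (forall w, val (pointD u s) w <= val (pointD v r) w) -> u = v /\ (s <= r)%R.
Proof.
by move=> /le_point_fun; rewrite /= /point_fun; case: eqP => [->|].
Qed.

(** Parallel affine functions are comparable, hence so are their images, and comparable point
    functions sit at the same point. *)
Lemma image_affine_slope u : exists w, forall a, exists s, S (affineX u a) = pointD w s.
Proof.
have [w [s ws]] := image_affine u 0; exists w => a.
have [v [r vr]] := image_affine u a; exists r; rewrite vr.
suff -> : v = w by [].
have [a0|a0] := leP 0%R a.
- have /le_S : forall x, val (affineX u 0%R) x <= val (affineX u a) x.
    by move=> x; rewrite lee_fin lerD2l.
  by rewrite ws vr => /le_pointD[].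
- have /le_S : forall x, val (affineX u a) x <= val (affineX u 0%R) x.
    by move=> x; rewrite lee_fin lerD2l ltW.
  by rewrite ws vr => /le_pointD[].
Qed.

Lemma image_point_slope x : exists y, forall r, exists b, S (pointX x r) = affineD y b.
Proof.
have [y [b yb]] := image_point x 0; exists y => r.
have [z [c zc]] := image_point x r; exists c; rewrite zc.
suff -> : z = y by [].
have slope (y1 y2 : X) b1 b2 :
    (forall u, val (affineD y1 b1) u <= val (affineD y2 b2) u) -> y1 = y2.
  move=> y12; apply: dual_separates => u.
  apply: (@le_affine_slope _ _ (evaluation_fun y1) (evaluation_fun y2) b1 b2).
  by move=> v; have := y12 v; rewrite lee_fin.
have [r0|r0] := leP 0%R r.
- have /le_S : forall t, val (pointX x 0) t <= val (pointX x r) t.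
    by apply/le_point_fun; rewrite /= /point_fun eqxx lee_fin.
  by rewrite yb zc => /slope.
- have /le_S : forall t, val (pointX x r) t <= val (pointX x 0) t.
    by apply/le_point_fun; rewrite /= /point_fun eqxx lee_fin ltW.
  by rewrite yb zc => /slope.
Qed.

Lemma order_reversing_pairing : exists (phi : continuous_dual X -> continuous_dual X)
    (theta : X -> X) (sigma : continuous_dual X -> R -> R) (beta : X -> R -> R),
  [/\ forall u a, val (S (affineX u a)) = point_fun (phi u) (sigma u a),
    (forall w, exists u, phi u = w) /\ (forall y, exists x, theta x = y),
    forall u, {homo sigma u : a b / (a <= b)%R >-> (b <= a)%R},
    forall u, injective (sigma u) &
    forall u x a, (phi u (theta x) + beta x (u x + a) = sigma u a)%R].
Proof.
have [phi Hphi] := choice image_affine_slope.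
have [theta Htheta] := choice image_point_slope.
have [sigma Hsigma] : exists sigma, forall u a,
    S (affineX u a) = pointD (phi u) (sigma u a).
  exists (fun u => projT1 (choice (Hphi u))) => u.
  exact: projT2 (choice (Hphi u)).
have [beta Hbeta] : exists beta, forall x r,
    S (pointX x r) = affineD (theta x) (beta x r).
  exists (fun x => projT1 (choice (Htheta x))) => x.
  exact: projT2 (choice (Htheta x)).
have phi_surj w : exists u, phi u = w.
  have [u [a]] := preimage_point w 0; rewrite Hsigma => /(congr1 val)/point_fun_inj[uw _].
  by exists u.
have theta_surj y : exists x, theta x = y.
  have [x [r]] := preimage_affine y 0; rewrite Hbeta => /(congr1 val)/= e.
  exists x; apply: dual_separates => u.
  apply: (@le_affine_slope _ _ (evaluation_fun (theta x)) (evaluation_fun y) (beta x r) 0).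
  by move=> v; have := congr1 (fun f => f v) e; rewrite /= => -[<-].
have S_inj f g : S f = S g -> f = g.
  move=> fg; apply/val_inj/funext => x; apply/eqP; rewrite eq_le.
  by apply/andP; split; move: x; apply/le_S; rewrite fg.
have sigma_anti u : {homo sigma u : a b / (a <= b)%R >-> (b <= a)%R}.
  move=> a b ab; have /le_S : forall x, val (affineX u a) x <= val (affineX u b) x.
    by move=> x; rewrite lee_fin lerD2l.
  by rewrite !Hsigma => /le_pointD[].
have sigma_inj u : injective (sigma u).
  move=> a b ab; have /S_inj/(congr1 (fun f => val f 0%R)) : S (affineX u a) = S (affineX u b).
    by rewrite !Hsigma ab.
  by move=> /= [/addrI].
(* The preimage of the point function at [(phi u, s)] has a slope [v] with [phi v = phi u]. Point
   functions at one point are comparable, so the affine functions of slopes [u] and [v] are too, and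
   [u = v]. *)
have sigma_surj u s : exists a, sigma u a = s.
  have [v [a]] := preimage_point (phi u) s.
  rewrite Hsigma => /(congr1 val)/point_fun_inj[vu vs].
  suff uv : u = v by exists a; rewrite uv.
  have [us|su] := leP (sigma u 0%R) (sigma v a).
  - have : forall w, val (S (affineX u 0%R)) w <= val (S (affineX v a)) w.
      by rewrite !Hsigma vu; apply/le_point_fun; rewrite /= /point_fun eqxx lee_fin.
    by move=> /le_S/le_affineX[].
  - have : forall w, val (S (affineX v a)) w <= val (S (affineX u 0%R)) w.
      by rewrite !Hsigma vu; apply/le_point_fun; rewrite /= /point_fun eqxx lee_fin ltW.
    by move=> /le_S/le_affineX[].
have rel u x a r : (u x + a <= r <-> phi u (theta x) + beta x r <= sigma u a)%R.
  have := le_S (affineX u a) (pointX x r); rewrite Hsigma Hbeta => [[AB BA]]; split=> h.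
  - have /AB/(_ (phi u)) : forall y, val (affineX u a) y <= val (pointX x r) y.
      by apply/le_point_fun; rewrite lee_fin.
    by rewrite /= /point_fun eqxx lee_fin.
  - have /BA/(_ x) : forall w, val (affineD (theta x) (beta x r)) w <=
        val (pointD (phi u) (sigma u a)) w.
      by apply/le_point_fun; rewrite lee_fin.
    by rewrite /= /point_fun eqxx lee_fin.
exists phi, theta, sigma, beta; split=> // [u a|u x a].
  by rewrite Hsigma.
(* If the inequality from [rel] were strict, an [a'] with [sigma u a'] equal to the left-hand side
   would satisfy [a' <= a] by [rel], so [sigma u a <= sigma u a'], a contradiction. *)
apply/eqP; rewrite eq_le (rel _ _ _ _).1//= leNgt; apply/negP => lt_s.
have [a' a's] := sigma_surj u (phi u (theta x) + beta x (u x + a))%R.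
have := (rel u x a' (u x + a)%R).2; rewrite a's => /(_ (lexx _)).
by rewrite lerD2l => /(sigma_anti u); rewrite a's leNgt lt_s.
Qed.

End order_reversing.

(** * From the pairing to the conjugate formula *)

Section conjugate_formula.
Context {R : realType} {X : normedModType R}.

(** Reduces comparisons to real upper bounds, which for conjugates are conditions on affine
    minorants. *)
Lemma lee_EFin_ub (a b : \bar R) : (forall s, b <= s%:E -> a <= s%:E) -> a <= b.
Proof.
move=> ba; rewrite leNgt; apply/negP; case: b ba => [b ba|ba|ba].
- by rewrite ltNge ba.
- by rewrite ltNge leey.
case: a ba => [a ba _|ba _|//].
- by have := ba (a - 1)%R; rewrite leNye lee_fin => /(_ isT); lra.
- by have := ba 0%R; rewrite leNye => /(_ isT).
Qed.

Lemma fenchel_conjugate_le (f : X -> \bar R) u c :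
  (fenchel_conjugate f u <= c%:E) <-> (forall x, (u x - c)%:E <= f x).
Proof.
have iff x : (u x)%:E - f x <= c%:E <-> (u x - c)%:E <= f x.
  case: (f x) => [b| |] //; last by rewrite leey /= addeNy leNye.
  by rewrite -EFinB !lee_fin lerBlDr lerBlDl.
split=> [fc x|fc].
  by apply/iff; apply: le_trans fc; apply: ereal_sup_ubound; exists x.
by apply: ge_ereal_sup => _ [x _ <-]; apply/iff.
Qed.

Lemma conjugate_formula_le (f : X -> \bar R) (H : {linear X -> X})
    (cH : continuous H) (u v : continuous_dual X) (y : X) (tau rho s : R) :
  (0 < tau)%R ->
  (tau%:E * fenchel_conjugate f (adjoint cH u + v)%R + (u y)%:E + rho%:E <= s%:E)
  <-> (forall x, (u (H x) + v x - (s - u y - rho) / tau)%:E <= f x).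
Proof.
move=> tau0; apply: iff_trans (fenchel_conjugate_le _ (adjoint cH u + v)%R _).
case: (fenchel_conjugate f _) => [b| |].
- rewrite -EFinM -!EFinD !lee_fin ler_pdivlMr// mulrC.
  by split; lra.
- by rewrite gt0_muley ?lte_fin// !addye.
- by rewrite gt0_muleNy ?lte_fin// !addNye !leNye.
Qed.

End conjugate_formula.

Lemma fully_order_reversing_formula (R : realType) (X : completeNormedModType R)
    (X_neq0 : exists x : X, (x != 0)%R)
    (S : convex_lsc X -> convex_wstar_lsc X) : fully_order_reversing S ->
  exists (v : continuous_dual X) (y : X) (rho tau : R)
         (H : {linear X -> X}) (cH : continuous H),
    [/\ (0 < tau)%R, bijective H &
      forall (f : convex_lsc X) (u : continuous_dual X),
        val (S f) u = (tau%:E * fenchel_conjugate (val f) (adjoint cH u + v)%R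
            + (u y)%:E + rho%:E)%E].
Proof.
move=> revS.
have [phi [theta [sigma [beta [Saff [phi_surj theta_surj] s_anti s_inj eqn]]]]] :=
  order_reversing_pairing revS.
have [u0 [x0 [tau [b0 [tau0 pair sigmaE]]]]] :=
  pairing_equation X_neq0 phi_surj theta_surj s_anti s_inj eqn.
have phi0_surj w : exists u, phi (u0 + u)%R = w.
  by have [u <-] := phi_surj w; exists (u - u0)%R; rewrite subrKC.
have theta0_surj y : exists z, theta (x0 + z)%R = y.
  by have [z <-] := theta_surj y; exists (z - x0)%R; rewrite subrKC.
have [H [cH bijH phiH]] :=
  @pairing_automorphism R X _ _ tau tau0 phi0_surj theta0_surj pair.
(* The last two terms of the formula undo the translations by [x0] and [u0]: if [w = phi (u0 + u)],
   then [u] is the adjoint image of [w], and they add up to [b0 - tau * (u + u0) x0]. *)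
exists u0, (- tau *: H x0)%R, (b0 - tau * u0 x0)%R, tau, H, cH; split=> // f w.
have [u phiu] := phi0_surj w.
have wH z : w (H z) = u z by rewrite -phiu phiH.
have iff s : val (S f) w <= s%:E <->
    forall x, (w (H x) + u0 x - (s - w (- tau *: H x0) - (b0 - tau * u0 x0)) / tau)%:E
      <= val f x.
  (* The solution of [sigma (u0 + u) a = s], so that [S] sends the affine function [A] to the point
     function at [(w, s)]. *)
  pose a := ((b0 - s) / tau - (u x0 + u0 x0))%R.
  have sE : sigma (u0 + u)%R a = s.
    rewrite sigmaE dualDE /a; move: (u x0) (u0 x0) => p q.
    by field; rewrite gt_eqF.
  pose A : convex_lsc X := SigSub (mem_set (affine_convex_lsc (u0 + u)%R a)).
  have SA : val (S A) = point_fun w s by rewrite Saff sE phiu.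
  have := revS.2 A f; rewrite SA le_point_fun => <-.
  suff E x : (w (H x) + u0 x - (s - w (- tau *: H x0) - (b0 - tau * u0 x0)) / tau)%R
      = ((u0 + u) x + a)%R.
    by split=> Af x; have := Af x; rewrite E.
  rewrite dual_scale !wH dualDE /a; move: (u x) (u0 x) (u x0) (u0 x0) => p q p0 q0.
  by field; rewrite gt_eqF.
apply/eqP; rewrite eq_le; apply/andP; split; apply: lee_EFin_ub => s.
- by move/conjugate_formula_le => /(_ tau0)/iff.
- by move/iff => ?; apply/conjugate_formula_le.
Qed.

Local Close Scope ereal_scope.

(** * The converse *)

Section bounded_inverse.
Context {R : realType} {X : completeNormedModType R}.
Variables (H : {linear X -> X}) (g : X -> X).
Hypotheses (cH : continuous H) (gK : cancel g H) (Hg : cancel H g).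

Let g_linear : linear g.
Proof. by move=> a x y; apply: (can_inj Hg); rewrite linearP !gK. Qed.

Let g0 : g 0 = 0.
Proof. by have := Hg 0; rewrite linear0. Qed.

Let gZ a x : g (a *: x) = a *: g x.
Proof. by have := g_linear a x 0; rewrite g0 !addr0. Qed.

Let gD x y : g (x + y) = g x + g y.
Proof. by have := g_linear 1 x y; rewrite !scale1r. Qed.

Let gB x y : g (x - y) = g x - g y.
Proof. by rewrite -scaleN1r gD gZ scaleN1r. Qed.

(** By Baire, some set [C n] contains a ball around [x] of radius [r]. For [t = r / (2 |y|)],
    approximations of [x + t y] and of [x] differ by an approximation of [t y] whose image under [g]
    has norm at most [2 n]; dividing by [t] gives [M = 4 n / r]. *)
Lemma bounded_inverse_approx : exists2 M, 0 <= M &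
  forall y e, 0 < e -> exists2 y', `|y - y'| < e & `|g y'| <= M * `|y|.
Proof.
pose C (n : nat) := closure [set y | `|g y| <= n%:R].
have [n [W [[x [oO Ox]] OC]]] : exists n (W : set X),
    (exists x, open_nbhs x W) /\ W `&` ~` C n = set0.
  apply: contrapT => nC.
  have : dense (\bigcap_n ~` C n).
    apply: Baire => n; split; first exact/closed_openC/closed_closure.
    apply: contrapT => /denseNE[W HW]; apply: nC; exists n, W; exact: HW.
  move=> /(_ setT)[||y [_ /(_ (Num.truncn `|g y|).+1 Logic.I)]].
  - by exists 0.
  - exact: openT.
  - by apply; apply: subset_closure => /=; rewrite ltW// truncnS_gt.
have [r /= r0 xr] : exists2 r, 0 < r & ball x r `<=` W.
  by have /nbhs_ballP[r r0 xr] := open_nbhs_nbhs (conj oO Ox); exists r.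
have appr y d : ball x r y -> 0 < d -> exists2 a, `|y - a| < d & `|g a| <= n%:R.
  move=> /xr Wy d0; have Cy : C n y.
    by apply: contrapT => nCy; have : (W `&` ~` C n) y by []; rewrite OC.
  by have [a [an /=]] := Cy _ (nbhsx_ballx y d d0); rewrite -ball_normE/= => ya; exists a.
exists (4 * n%:R / r); first by rewrite divr_ge0 ?mulr_ge0// ltW.
move=> y e e0; have [->|yn0] := eqVneq y 0.
  exists 0; first by rewrite subrr normr0.
  by rewrite g0 !normr0 mulr0.
have y0 : 0 < `|y| by rewrite normr_gt0.
pose t := r / (2 * `|y|); have t0 : 0 < t by rewrite divr_gt0// mulr_gt0.
have te : 0 < t * e / 2 by rewrite divr_gt0// mulr_gt0.
have [|a xa an] := appr (x + t *: y) _ _ te.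
  rewrite -ball_normE/= opprD addrA subrr sub0r normrN normrZ gtr0_norm//.
  have -> : t * `|y| = r / 2 by rewrite /t; field; rewrite gt_eqF.
  by lra.
have [|b xb bn] := appr x _ _ te; first exact: ballxx.
exists (t^-1 *: (a - b)).
  have -> : y - t^-1 *: (a - b) = t^-1 *: ((x + t *: y - a) - (x - b)).
    have -> : x + t *: y - a - (x - b) = t *: y - (a - b).
      by rewrite !opprB -!addrA [LHS]addrC -!addrA addNr addr0 [- a + b]addrC.
    by rewrite [RHS]scalerBr scalerA mulVf ?gt_eqF// scale1r.
  rewrite normrZ gtr0_norm ?invr_gt0// mulrC ltr_pdivrMr//.
  by rewrite (le_lt_trans (ler_normB _ _))//; lra.
rewrite gZ normrZ gtr0_norm ?invr_gt0// gB.
have -> : 4 * n%:R / r * `|y| = t^-1 * (n%:R + n%:R).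
  by rewrite /t; field; rewrite !gt_eqF.
by rewrite ler_pM2l ?invr_gt0// (le_trans (ler_normB _ _))// lerD.
Qed.

(** Successive approximation: the residuals [r n] halve, so the images under [g] of their
    approximations form an absolutely convergent series with sum of norm at most [2 M |y|].
    Continuity of [H] maps the sum to [y], so the sum is [g y]. *)
Theorem bounded_inverse : exists K, forall y, `|g y| <= K * `|y|.
Proof.
have [M M0 appr] := bounded_inverse_approx.
have /choice[c cP] : forall y, exists y', `|y - y'| <= `|y| / 2 /\ `|g y'| <= M * `|y|.
  move=> y; have [->|yn0] := eqVneq y 0.
    by exists 0; rewrite subrr g0 normr0 mul0r mulr0.
  have [|y' /ltW] := appr y (`|y| / 2); last by exists y'.
  by rewrite divr_gt0 ?normr_gt0.
exists (2 * M) => y.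
pose r := fix r n := if n is n.+1 then r n - c (r n) else y.
have r_le n : `|r n| <= `|y| / 2 ^+ n.
  elim: n => [|n IH]; first by rewrite expr0 divr1.
  apply: (le_trans (cP (r n)).1); rewrite exprSr invfM mulrA.
  by rewrite ler_pM2r ?invr_gt0.
pose u n := g (c (r n)).
have u_le n : `|u n| <= (M * `|y|) / 2 ^+ n.
  by apply: (le_trans (cP (r n)).2); rewrite -mulrA ler_wpM2l.
have sS n : series u n.+1 = series u n + u n by rewrite /series/= big_nat_recr.
have sE n : series u n = g (y - r n).
  elim: n => [|n IH]; first by rewrite /series/= big_geq// subrr g0.
  rewrite sS IH -gD.
  by rewrite opprB [c _ - _]addrC addrA.
have half : `|2^-1 : R| < 1 by rewrite gtr0_norm ?invr_gt0//; lra.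
have cu : cvgn (series u).
  have u_geo n : `|u n| <= geometric (M * `|y|) 2^-1 n by rewrite /= exprVn.
  apply: normed_cvg; apply: (series_le_cvg _ _ u_geo) => // [n|].
    by rewrite (le_trans _ (u_geo n)).
  exact: is_cvg_geometric_series.
have s_le n : `|series u n| <= 2 * M * `|y|.
  (* The exact partial sum of the dominating geometric series, which makes the induction close. *)
  suff : `|series u n| <= M * `|y| * (2 - 2 / 2 ^+ n).
    move=> h; apply: (le_trans h).
    have : 0 <= M * `|y| * (2 / 2 ^+ n) by rewrite !mulr_ge0// invr_ge0 exprn_ge0.
    by lra.
  elim: n => [|n IH]; first by rewrite /series/= big_geq// normr0 expr0 divr1 subrr mulr0.
  rewrite sS; apply: (le_trans (ler_normD _ _)); apply: (le_trans (lerD IH (u_le n))).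
  by rewrite exprSr invfM; move: (2 ^- n) => q; lra.
have r0 : r n @[n --> \oo] --> (0 : X).
  apply/norm_cvg0P; apply: (@squeeze_cvgr _ _ _ _ (fun=> 0) (geometric `|y| 2^-1)).
  - by near=> n; rewrite normr_ge0 /geometric/= exprVn r_le.
  - exact: cvg_cst.
  - exact: cvg_geometric.
have Hlim : H (limn (series u)) = y.
  apply: (@cvg_unique X (@norm_hausdorff _ _) (H (series u n) @[n --> \oo])).
    by apply: continuous_cvg => //; exact: cH.
  rewrite (_ : (fun n => H (series u n)) = (fun n => y - r n)); last first.
    by apply/funext => n; rewrite sE gK.
  have : (y - r n) @[n --> \oo] --> y - 0 by apply: cvgB => //; exact: cvg_cst.
  by rewrite subr0.
rewrite -[in leLHS]Hlim Hg.
apply: (cvgr_to_le (cvg_norm cu)).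
by near=> n; exact: s_le.
Unshelve. all: by end_near. Qed.

End bounded_inverse.

(** The preimage of [u] is [u] composed with the inverse of [H], which is bounded. *)
Lemma adjoint_surjective (R : realType) (X : completeNormedModType R)
    (H : {linear X -> X}) (cH : continuous H) : bijective H ->
  forall u, exists w, adjoint cH w = u.
Proof.
move=> [g Hg gK] u.
have [M gM] := bounded_inverse cH gK Hg; have [K K0 uK] := dual_bounded u.
have lug : linear (fun x => u (g x) : R^o).
  move=> a x y; rewrite -dual_linear; congr (u _).
  by apply: (can_inj Hg); rewrite linearP !gK.
have [|w wE] := @continuous_dual_of_bounded R X (pack_linear lug) (K * M).
  by move=> x; rewrite (le_trans (uK _))// -mulrA ler_pM2l.
by exists w; apply: dual_ext => x; rewrite /= wE/= Hg.
Qed.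

(** * Operators given by the formula *)

Local Open Scope ereal_scope.

Lemma convex_lsc_sup_affine (R : realType) (X : normedModType R)
    (D : set (continuous_dual X * R)) x0 : D !=set0 ->
  ereal_sup [set (ua.1 x0 + ua.2)%:E | ua in D] != +oo ->
  convex_lsc X (fun x => ereal_sup [set (ua.1 x + ua.2)%:E | ua in D]).
Proof.
move=> [ua Dua] supx0.
have supD x ub : D ub -> (ub.1 x + ub.2)%:E <=
    ereal_sup [set (ua.1 x + ua.2)%:E | ua in D].
  by move=> Dub; apply: ereal_sup_ubound; exists ub.
split.
- split=> [x|]; last by exists x0.
  by rewrite gt_eqF// (lt_le_trans _ (supD x _ Dua))// ltNyr.
- move=> x y t /andP[t0 t1]; apply: ge_ereal_sup => _ [ub Dub <-].
  have -> : (ub.1 (t *: x + (1 - t) *: y) + ub.2)%:E =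
      t%:E * (ub.1 x + ub.2)%:E + (1 - t)%:E * (ub.1 y + ub.2)%:E.
    rewrite -!EFinM -EFinD dual_add !dual_scale; congr (_%:E).
    by move: (ub.1 x) (ub.1 y) => p q; ring.
  by apply: leeD; apply: lee_wpmul2l; 
    rewrite ?lee_fin ?subr_ge0 ?(ltW t0) ?(ltW t1)//; exact: supD.
- move=> x a /ereal_sup_gt[_ [ub Dub <-]] aub.
  have [_ _ /(_ x a aub)[V xV Va]] := affine_convex_lsc ub.1 ub.2.
  by exists V => // z /Va/lt_le_trans; apply; exact: supD.
Qed.

Lemma formula_fully_order_reversing (R : realType) (X : completeNormedModType R)
    (S : convex_lsc X -> convex_wstar_lsc X) (v : continuous_dual X) (y : X)
    (rho tau : R) (H : {linear X -> X}) (cH : continuous H) :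
  (0 < tau)%R -> bijective H ->
  (forall (f : convex_lsc X) (u : continuous_dual X),
    val (S f) u = (tau%:E * fenchel_conjugate (val f) (adjoint cH u + v)%R
            + (u y)%:E + rho%:E)%E) ->
  fully_order_reversing S.
Proof.
move=> tau0 bijH SE.
have SP f u s : val (S f) u <= s%:E <->
    forall x, (u (H x) + v x - (s - u y - rho) / tau)%:E <= val f x.
  by rewrite SE; exact: conjugate_formula_le.
split=> [g|f g]; last first.
  split=> [fg u|Sgf x].
    by apply: lee_EFin_ub => s /SP fs; apply/SP => x; exact: le_trans (fs x) (fg x).
  rewrite leNgt; apply/negP => gf.
  have [[gNy _] _ _] : convex_lsc X (val g) by exact: set_valP.
  have [r gr] : exists r, val g x = r%:E.
    have := gNy x; have := lt_le_trans gf (leey _).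
    by case: (val g x) => // r; exists r.
  (* An affine minorant of [f] exceeds [g] at [x]. Surjectivity of the adjoint encodes it as a bound
     [S f w <= s']; then [S g w <= s'] makes it a minorant of [g], which is absurd. *)
  move: gf; rewrite gr => /EFin_lt_dense[s rs /(affine_minorant (set_valP f))].
  move=> [u [a [ua ux]]].
  have [w wE] := adjoint_surjective cH bijH (u - v)%R.
  pose s' := (w y + rho - tau * a)%R.
  have ws : (- ((s' - w y - rho) / tau) = a)%R.
    by rewrite /s'; move: (w y) => p; field; rewrite gt_eqF.
  have wx z : (w (H z) + v z = u z)%R.
    have -> : w (H z) = (u - v)%R z by rewrite -wE.
    by rewrite dualBE subrK.
  have : val (S f) w <= s'%:E by apply/SP => z; rewrite wx ws.
  move=> /(le_trans (Sgf w))/SP/(_ x); rewrite wx ws ux gr lee_fin.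
  by rewrite leNgt rs.
have Cg : convex_wstar_lsc X (val g) by exact: set_valP.
have [[gNy [u0 gu0]] _ _] := Cg.
(* F is the supremum of the affine functions that the formula attaches to the
   points (u, s) of the epigraph of g. *)
pose D := [set ua : continuous_dual X * R | exists u s,
  val g u <= s%:E /\ ua = ((adjoint cH u + v)%R, (- ((s - u y - rho) / tau))%R)].
pose F x := ereal_sup [set (ua.1 x + ua.2)%:E | ua in D].
(* Affine minorants of [g] bound [F] from above pointwise; as [H] is onto, every slope [z] has the
   form [y + tau *: H x]. *)
have F_le x (b : R) :
    (forall u : continuous_dual X, (u (y + tau *: H x) + b)%:E <= val g u) ->
    F x <= (v x + (rho - b) / tau)%:E.
  move=> gb; apply: ge_ereal_sup => _ [_ [u [s [us ->]]] <-].
  rewrite -[leLHS]/((u (H x) + v x - (s - u y - rho) / tau)%:E).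
  have := le_trans (gb u) us; rewrite !lee_fin dual_add dual_scale.
  move: (u y) (u (H x)) (v x) => p q r; rewrite -subr_ge0 => h.
  rewrite -subr_ge0 (_ : _ - _ = (s - (p + tau * q + b)) / tau)%R; last first.
    by field; rewrite gt_eqF.
  by rewrite divr_ge0// ltW.
have gmin (u : continuous_dual X) s : s%:E < val g u -> exists x (b : R),
    (forall w : continuous_dual X, (w (y + tau *: H x) + b)%:E <= val g w) /\
    (u (y + tau *: H x) + b)%R = s.
  move=> /(weak_star_affine_minorant Cg)[z [b [zb zu]]].
  have [h _ hK] := bijH; exists (h (tau^-1 *: (z - y)))%R, b.
  by rewrite hK scalerA mulfV ?gt_eqF// scale1r subrKC.
have [s0 gu0s] : exists s0, val g u0 = s0%:E.
  by have := gNy u0; case: (val g u0) gu0 => // r _ _; exists r.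
(* Any one minorant of [g] makes [F] finite somewhere, hence proper. *)
have [|x0 [b0 [/F_le Fx0 _]]] := gmin u0 (s0 - 1)%R.
  by rewrite gu0s lte_fin; lra.
have CF : convex_lsc X F.
  apply: (@convex_lsc_sup_affine _ _ _ x0).
    by exists ((adjoint cH u0 + v)%R, (- ((s0 - u0 y - rho) / tau))%R), u0, s0; rewrite gu0s.
  by rewrite lt_eqF// (le_lt_trans Fx0)// ltry.
exists (SigSub (mem_set CF)); apply/val_inj/funext => u.
apply/eqP; rewrite eq_le; apply/andP; split; apply: lee_EFin_ub => s.
  move=> gus; apply/SP => x; apply: ereal_sup_ubound.
  by exists ((adjoint cH u + v)%R, (- ((s - u y - rho) / tau))%R) => //; exists u, s.
(* If [s < g u], a minorant of [g] with value [s' > s] at [u] bounds [F] at some [x] below what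
   [S F u <= s] requires there. *)
move=> /SP Fs; rewrite leNgt; apply/negP => /EFin_lt_dense[s' ss'].
move=> /gmin[x [b [/F_le Fx ux]]].
have := le_trans (Fs x) Fx; rewrite lee_fin; move: ux; rewrite dual_add dual_scale.
move: (u y) (u (H x)) (v x) => p q r ux h.
suff : (0 <= (s - s') / tau)%R by rewrite pmulr_lge0 ?invr_gt0// subr_ge0 leNgt ss'.
have -> : ((s - s') / tau = (r + (rho - b) / tau) - (q + r - (s - p - rho) / tau))%R.
  by rewrite -ux; field; rewrite gt_eqF.
by rewrite subr_ge0.
Qed.

Local Close Scope ereal_scope.

Theorem theorem2 (R : realType) (X : completeNormedModType R)
    (X_neq0 : exists x : X, x != 0)
    (S : convex_lsc X -> convex_wstar_lsc X) :
  fully_order_reversing S <->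
  exists (v : continuous_dual X) (y : X) (rho tau : R)
         (H : {linear X -> X}) (cH : continuous H),
    [/\ 0 < tau, bijective H &
      forall (f : convex_lsc X) (u : continuous_dual X),
        val (S f) u =
          (tau%:E * fenchel_conjugate (val f) (adjoint cH u + v)%R
            + (u y)%:E + rho%:E)%E].
Proof.
split=> [|[v [y [rho [tau [H [cH [tau0 bijH SE]]]]]]]].
  exact: fully_order_reversing_formula.
exact: formula_fully_order_reversing SE.
Qed.
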